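(* Suppose the direct mechanism $(x,t)$ is strictly Bayes incentive compatible with quasi-linear preferences. Then there exists an ordinally incentive compatible direct mechanism $(x,\tau)$ that implements the same physical allocation $x$ and raises the same expected revenue from each agent given each vector of reported types $\hat\theta \in \Theta$, i.e. $$\mathbb{E}[\tau_i(\hat\theta)] = \mathbb{E}[t_i(\hat\theta)] \quad\text{for every agent } i.$$
   Context: There are $n$ agents; agent $i$'s type is $\theta_i \in \Theta_i$, the set $\Theta=\prod_{i=1}^n\Theta_i$ is finite, and $\theta=(\theta_1,\dots,\theta_n)$ is drawn from some joint distribution on $\Theta$. Statements conditional on $\theta_i$ refer to types of positive probability. $X$ is a set of physical allocations, and for each $i$ a function $v_i: X\times\Theta\to\mathbb{R}$ is given (the monetary value to agent $i$ of an allocation when the true type profile is $\theta$). A direct mechanism $(x,t)$ consists of an allocation function $x:\Theta\to X$ and a (random) transfer function $t:\Theta\to\Delta(\mathbb{R}^n)$, where $\Delta(\mathbb{R}^n)$ is the set of probability distributions on $\mathbb{R}^n$; given a reported profile $\hat\theta$, the random vector of transfers $t(\hat\theta)=(t_1(\hat\theta),\dots,t_n(\hat\theta))$ is drawn from the prescribed distribution, which depends on the reports only. Attention is restricted to mechanisms in which every random transfer $t_i(\hat\theta)$ has all moments finite; this applies to both $t$ and $\tau$. Agent $i$ has a utility function over money $u_i:\mathbb{R}\to\mathbb{R}$, bounded in absolute value by a polynomial; her utility is $u_i(v_i(x,\theta)-t_i)$. Given $u=(u_1,\dots,u_n)$, the mechanism $(x,t)$ satisfies ($u$-BIC) if for every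 agent $i$ and every type $\theta_i$, $$\theta_i \in \operatorname*{arg\,max}_{\hat\theta_i\in\Theta_i}\ \mathbb{E}\Big[u_i\big(v_i(x(\hat\theta_i,\theta_{-i}),\theta)-t_i(\hat\theta_i,\theta_{-i})\big)\,\Big|\,\theta_i\Big],$$ where the expectation is over $\theta_{-i}$ conditional on $\theta_i$ and over the randomness of the transfer. The mechanism is strictly Bayes incentive compatible with quasi-linear preferences if ($u$-BIC) holds with $u_i(z)=z$ for all $i$, and the maximum is uniquely attained (at $\hat\theta_i=\theta_i$) for every $i$ and $\theta_i$. The mechanism is ordinally incentive compatible if ($u$-BIC) is satisfied for all non-decreasing utility functions $u_1,\dots,u_n:\mathbb{R}\to\mathbb{R}$ that are each bounded in absolute value by a polynomial. *)

(* Defs.v *)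
From HB Require Import structures.
From mathcomp Require Import all_boot all_order all_algebra.
From mathcomp Require Import all_classical all_reals all_analysis.

Set Implicit Arguments.
Unset Strict Implicit.
Unset Printing Implicit Defensive.
Import Order.TTheory GRing.Theory Num.Theory.
Local Open Scope ring_scope.

Section Environment.
Context (R : realType) (n : nat) (Theta : 'I_n -> finType).

Definition profile := {dffun forall i : 'I_n, Theta i}.

(* The profile (a, th_{-i}). *)
Definition deviate (th : profile) (i : 'I_n) (a : Theta i) : profile :=
  [ffun j => dfwith th i a j].

Definition is_pmf (p : profile -> R) : Prop :=
  (forall th, 0 <= p th) /\ \sum_(th : profile) p th = 1.

Definition type_prob (p : profile -> R) (i : 'I_n) (a : Theta i) : R :=
  \sum_(th : profile | th i == a) p th.

(* An element of Delta(R^n): a Borel probability on R^n, the latter being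
   n.-tuple R with the product sigma-algebra. *)
Definition transfer_law := probability (n.-tuple R) R.

Definition transfer_of (i : 'I_n) : n.-tuple R -> R := fun y => tnth y i.

Definition finite_moments (t : profile -> transfer_law) : Prop :=
  forall (th : profile) (i : 'I_n) (k : nat),
    (t th).-integrable setT (fun y => (transfer_of i y ^+ k)%:E).

Definition poly_bounded (u : R -> R) : Prop :=
  exists q : {poly R}, forall z : R, `|u z| <= q.[z].

Context (X : Type).

(* Conditional expectation, given that agent i has type a, of her utility from
   reporting b while the others report truthfully. The allocation and the
   transfer depend on the reports, the valuation also on the true profile th.
   Only meaningful when type_prob p a > 0. *)
Definition interim_utility (p : profile -> R) (v : 'I_n -> X -> profile -> R)
    (x : profile -> X) (t : profile -> transfer_law)
    (i : 'I_n) (ui : R -> R) (a b : Theta i) : \bar R :=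
  (\sum_(th : profile | th i == a)
     (p th / type_prob p a)%:E *
     'E_(t (deviate th b))
        [fun y => ui (v i (x (deviate th b)) th - transfer_of i y)%R])%E.

Definition is_argmax (T : Type) (f : T -> \bar R) (a : T) : Prop :=
  forall b, (f b <= f a)%E.

Definition u_BIC (p : profile -> R) (v : 'I_n -> X -> profile -> R)
    (x : profile -> X) (t : profile -> transfer_law) (u : 'I_n -> R -> R) :
    Prop :=
  forall (i : 'I_n) (a : Theta i), 0 < type_prob p a ->
    is_argmax (interim_utility p v x t (u i) a) a.

Definition strictly_BIC_quasilinear (p : profile -> R)
    (v : 'I_n -> X -> profile -> R) (x : profile -> X)
    (t : profile -> transfer_law) : Prop :=
  u_BIC p v x t (fun _ z => z) /\
  (forall (i : 'I_n) (a : Theta i), 0 < type_prob p a ->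
     forall b, is_argmax (interim_utility p v x t (fun z => z) a) b -> b = a).

Definition ordinally_IC (p : profile -> R) (v : 'I_n -> X -> profile -> R)
    (x : profile -> X) (t : profile -> transfer_law) : Prop :=
  forall u : 'I_n -> R -> R,
    (forall i, {homo u i : y z / y <= z}) -> (forall i, poly_bounded (u i)) ->
    u_BIC p v x t u.

End Environment.

(* Main.v *)
Require Import Defs.
From HB Require Import structures.
From mathcomp Require Import all_boot all_order all_algebra.
From mathcomp Require Import all_classical all_reals all_analysis.
From mathcomp Require Import measurable_realfun lra ring.

Set Implicit Arguments.
Unset Strict Implicit.
Unset Printing Implicit Defensive.
Import Order.TTheory GRing.Theory Num.Theory.
Import numFieldNormedType.Exports.
Local Open Scope ring_scope.

(* Take [tau_i = E[t_i] + Z], where the noise [Z], common to all the agents, has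
   the Laplace density [(d / 2) exp (- d |z|)] for a small [d > 0]. By strict
   incentive compatibility a truthful report yields a lottery [A] over
   [v_i - E[t_i]] with [E[A] > E[B]], where [B] is the lottery of a misreport,
   so it is enough that [A - Z] dominates [B - Z] at first order for small [d].
   The difference [phi] of the two densities is of order [d^2], but beyond a
   bound [M] of [|A|] and [|B|] it has the sign of its argument and decays so
   slowly that it carries more mass on an interval of fixed length than on
   [[-M, M]]. Hence [int u phi >= 0] for every nondecreasing [u] with [u 0 = 0],
   a harmless normalization as [phi] integrates to zero. There are finitely many
   pairs of a type and a report, so a single [d] serves them all. *)

(** * Probability measures given by a density *)

Section density.
Context d (T : measurableType d) (R : realType).
Variables (mu : {sigma_finite_measure set T -> \bar R}) (g : T -> R).
Hypotheses (g_ge0 : forall x, 0 <= g x) (mg : measurable_fun setT g)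
  (g_int1 : (\int[mu]_x (g x)%:E = 1)%E).

Let mu_g (A : set T) : \bar R := (\int[mu]_(x in A) (g x)%:E)%E.

Let mu_g0 : mu_g set0 = 0%E.
Proof. exact: integral_set0. Qed.

Let mu_g_ge0 A : (0 <= mu_g A)%E.
Proof. by apply: integral_ge0 => x _; rewrite lee_fin. Qed.

Let mu_g_sigma_additive : semi_sigma_additive mu_g.
Proof.
move=> /= F mF tF mUF; rewrite /mu_g; apply: cvg_toP.
  apply: ereal_nondecreasing_is_cvgn => m n mn.
  by apply: lee_sum_nneg_natr => // k _ _; exact: mu_g_ge0.
rewrite ge0_integral_bigcup//=.
- exact/measurable_funTS/measurable_EFinP.
- by move=> x _; rewrite lee_fin.
Qed.

HB.instance Definition _ :=
  isMeasure.Build _ _ _ mu_g mu_g0 mu_g_ge0 mu_g_sigma_additive.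

HB.instance Definition _ :=
  @Measure_isProbability.Build _ _ R mu_g g_int1.

Lemma probability_of_density : exists P : probability T R,
  forall A, measurable A -> P A = (\int[mu]_(x in A) (g x)%:E)%E.
Proof. by exists mu_g. Qed.

End density.

(** * Integration against a measure with a density *)

Section integral_density.
Context d (T : measurableType d) (R : realType).
Variables (mu : {sigma_finite_measure set T -> \bar R}) (g : T -> R).
Hypotheses (g_ge0 : forall x, 0 <= g x) (mg : measurable_fun setT g).
Variable P : probability T R.
Hypothesis PE :
  forall A, measurable A -> P A = (\int[mu]_(x in A) (g x)%:E)%E.

Let P_dom : P `<< mu.
Proof.
apply/null_content_dominatesP => A mA A0; rewrite PE//.
apply: null_set_integral => //; apply: measurable_funTS.
exact/measurable_EFinP.
Qed.

(** [g] has the same integral as the Radon-Nikodym derivative of [P] over every measurable set, so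
    the two agree almost everywhere and the change of variables for the derivative passes to [g]. *)
Lemma ge0_integral_density (f : T -> \bar R) : (forall x, (0 <= f x)%E) ->
  measurable_fun setT f ->
  (\int[P]_x f x = \int[mu]_x (f x * (g x)%:E))%E.
Proof.
move=> f0 mf.
rewrite -(Radon_Nikodym_SigmaFinite.change_of_variables P_dom)//.
have irn := Radon_Nikodym_SigmaFinite.f_integrable P_dom.
apply: ae_eq_integral => //.
- by apply: emeasurable_funM => //; exact: measurable_int irn.
- by apply: emeasurable_funM => //; exact/measurable_EFinP.
- apply: ae_eqe_mul2l; apply: integral_ae_eq => //.
  + exact/measurable_EFinP.
  + by move=> A _ mA; rewrite -PE// -Radon_Nikodym_SigmaFinite.f_integral.
Qed.

(** The nonnegative case applied to [|h|] gives integrability; the argument with the derivative is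
    then repeated for the signed [h]. *)
Lemma integral_density (h : T -> R) : measurable_fun setT h ->
  mu.-integrable setT (fun x => (h x * g x)%:E) ->
  P.-integrable setT (EFin \o h) /\
  (\int[P]_x (h x)%:E = \int[mu]_x (h x * g x)%:E)%E.
Proof.
move=> mh ihg.
have ih : P.-integrable setT (EFin \o h).
  apply/integrableP; split; first exact/measurable_EFinP.
  rewrite ge0_integral_density//; last exact/measurableT_comp/measurableT_comp.
  case/integrableP: ihg => _; congr (_ < _)%E.
  by apply: eq_integral => x _; rewrite /= normrM (ger0_norm (g_ge0 x)).
split => //.
rewrite -(Radon_Nikodym_change_of_variables P_dom)//.
apply: ae_eq_integral => //.
- apply: emeasurable_funM; first exact/measurable_EFinP.
  by apply: measurable_int; exact: Radon_Nikodym_integrable.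
- exact: measurable_int ihg.
- under [X in ae_eq _ _ _ X]eq_fun do rewrite EFinM.
  apply: ae_eqe_mul2l; apply: integral_ae_eq => //.
  + exact: Radon_Nikodym_integrable.
  + exact/measurable_EFinP.
  + by move=> A _ mA; rewrite -PE// -Radon_Nikodym_integral.
Qed.

End integral_density.

(** * Invariance of Lebesgue measure under [z |-> s - z] *)

Section reflect_translate.
Context {R : realType}.
Local Notation mu := (@lebesgue_measure R).
Local Open Scope classical_set_scope.
Local Open Scope ereal_scope.

(** Lebesgue measure is determined by its values on the intervals []a, b]], and the preimage of such
    an interval is [[s - b, s - a[], of the same length. *)
Lemma lebesgue_measure_subl (s : R) (A : set R) : measurable A ->
  pushforward mu ((fun z => s - z)%R : _ -> measurableTypeR R) A = mu A.
Proof.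
move=> mA; apply/esym/lebesgue_measure_unique => //=.
  exact: measurable_funB.
move=> ms _ [[a b]] _ <-; rewrite /pushforward.
rewrite (_ : _ @^-1` _ = `[(s - b)%R, (s - a)%R[%classic); last first.
  by apply/seteqP; split => z /=; rewrite !in_itv/= => /andP[? ?];
    apply/andP; split; lra.
rewrite !lebesgue_measure_itv/= !lte_fin ltrD2l ltrN2.
by case: ifP => // _; rewrite -!EFinD; congr EFin; lra.
Qed.

Let msub (s : R) : measurable_fun setT (fun z : R => s - z)%R.
Proof. exact: measurable_funB. Qed.

Lemma integrable_subl (s : R) (f : R -> \bar R) :
  mu.-integrable setT f -> mu.-integrable setT (fun z : R => f (s - z)%R).
Proof.
move=> intf; have mf := measurable_int _ intf.
have mfs : measurable_fun setT (fun z : R => f (s - z)%R).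
  exact: measurableT_comp.
apply/integrableP; split => //.
case/integrableP: intf => _; congr (_ < _).
have -> : \int[mu]_x `|f x| =
    \int[pushforward mu
      ((fun z : R => s - z)%R : _ -> measurableTypeR R)]_x `|f x|.
  apply: eq_measure_integral => //=; first exact: msub.
  by move=> ms A mA _; exact/esym/lebesgue_measure_subl.
by rewrite ge0_integral_pushforward//; [exact: msub|exact: measurableT_comp].
Qed.

Lemma integral_subl (s : R) (f : R -> \bar R) : mu.-integrable setT f ->
  \int[mu]_z f (s - z)%R = \int[mu]_w f w.
Proof.
move=> intf; have mf := measurable_int _ intf.
transitivity (\int[pushforward mu
    ((fun z : R => s - z)%R : _ -> measurableTypeR R)]_x f x); last first.
  apply: eq_measure_integral => //=; first exact: msub.
  by move=> ms A mA _; exact/lebesgue_measure_subl.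
by rewrite integral_pushforward//; [exact: msub|exact: integrable_subl].
Qed.

End reflect_translate.

(** * The Laplace density and its moments *)

Section laplace.
Context {R : realType}.
Local Notation mu := (@lebesgue_measure R).

Definition laplace_pdf (d z : R) : R := d / 2 * expR (- (d * `|z|)).

Lemma laplace_pdf_ge0 d z : 0 <= d -> 0 <= laplace_pdf d z.
Proof. by move=> d0; rewrite mulr_ge0 ?expR_ge0 ?divr_ge0. Qed.

Lemma laplace_pdfN d z : laplace_pdf d (- z) = laplace_pdf d z.
Proof. by rewrite /laplace_pdf normrN. Qed.

Lemma continuous_laplace_pdf d : continuous (laplace_pdf d).
Proof.
move=> z; apply: cvgM; first exact: cvg_cst.
apply: (cvg_comp _ expR); last exact: continuous_expR.
apply: (@cvgN _ R^o); apply: cvgM; first exact: cvg_cst.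
exact: norm_continuous.
Qed.

Lemma measurable_laplace_pdf d : measurable_fun setT (laplace_pdf d).
Proof. by apply: continuous_measurable_fun; exact: continuous_laplace_pdf. Qed.

(** By evenness the integral is twice the one over [[0, +oo[], where the doubled density is the
    exponential density of rate [d]. *)
Lemma integral_laplace_pdf d : 0 < d ->
  (\int[mu]_z (laplace_pdf d z)%:E = 1)%E.
Proof.
move=> d0.
rewrite ge0_symfun_integralT; first last.
- by move=> z /=; rewrite laplace_pdfN.
- exact: continuous_laplace_pdf.
- by move=> z; rewrite laplace_pdf_ge0// ltW.
rewrite -ge0_integralZl//=; first last.
- by move=> z _; rewrite lee_fin laplace_pdf_ge0// ltW.
- apply/measurable_EFinP; apply: measurable_funTS.
  exact: measurable_laplace_pdf.
- by rewrite -set_itvcy.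
rewrite -set_itvcy -(integral_exponential_pdf d0) [RHS](_ : _ =
   \int[mu]_(x in `[0%R, +oo[) (exponential_pdf d x)%:E)%E; last first.
  rewrite [RHS]integral_mkcond; apply: eq_integral => z _.
  rewrite patchE; case: ifPn => //; rewrite notin_setE/= in_itv/= andbT.
  by move=> /negP; rewrite -ltNge => z0; rewrite lt0_exponential_pdf.
apply: eq_integral => z; rewrite inE/= in_itv/= andbT => z0.
rewrite exponential_pdfE// /laplace_pdf -EFinM ger0_norm// mulNr.
by congr EFin; field.
Qed.

Lemma integrable_laplace_pdf d : 0 < d ->
  mu.-integrable setT (fun z => (laplace_pdf d z)%:E).
Proof.
move=> d0; apply/integrableP; split.
  by apply/measurable_EFinP; exact: measurable_laplace_pdf.
under eq_integral do rewrite /= ger0_norm ?laplace_pdf_ge0 ?ltW//.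
by rewrite integral_laplace_pdf// ltry.
Qed.

Lemma exprn_le_expR n (x : R) : 0 <= x -> x ^+ n <= n`!%:R * expR x.
Proof.
case: n => [|n] x0.
  by rewrite expr0 fact0 mul1r -expR0 ler_expR.
rewrite -ler_pdivrMl ?ltr0n ?fact_gt0// mulrC.
by apply: le_trans (expR_ge1Dxn n x0); rewrite lerDr.
Qed.

(** Half of the exponential rate is spent on absorbing the power; the other half leaves a multiple
    of the integrable density of rate [d / 2]. *)
Lemma integrable_exprn_laplace n d : 0 < d ->
  mu.-integrable setT (fun z => (z ^+ n * laplace_pdf d z)%:E).
Proof.
move=> d0; have d20 : 0 < d / 2 by rewrite divr_gt0.
(* With [y = d / 2 * |z|], the factorial bounds [y ^+ n * expR (- y)], the power of [d / 2] rescales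
   [y ^+ n] to [|z| ^+ n], and 2 is the ratio of the prefactors of the two densities. *)
pose c := n`!%:R * (d / 2) ^- n * 2.
have : mu.-integrable setT (fun z => c%:E * (laplace_pdf (d / 2) z)%:E)%E.
  by apply: integrableZl => //; exact: integrable_laplace_pdf.
apply: le_integrable => //.
  apply/measurable_EFinP; apply: measurable_funM => //.
  exact: measurable_laplace_pdf.
move=> z _; rewrite -EFinM !abse_EFin lee_fin [leRHS]ger0_norm; last first.
  by rewrite /c !mulr_ge0 ?laplace_pdf_ge0 ?invr_ge0 ?exprn_ge0// ltW.
rewrite normrM (ger0_norm (laplace_pdf_ge0 _ (ltW d0))) normrX.
have -> : laplace_pdf d z =
    2 * laplace_pdf (d / 2) z * expR (- (d / 2 * `|z|)).
  rewrite /laplace_pdf (_ : - (d * `|z|) =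
    - (d / 2 * `|z|) + - (d / 2 * `|z|)) ?expRD; last by field.
  by field.
set y := d / 2 * `|z|; set L := laplace_pdf _ _.
have L0 : 0 <= L by rewrite laplace_pdf_ge0// ltW.
have -> : `|z| ^+ n = y ^+ n * (d / 2) ^- n.
  by rewrite /y exprMn mulrAC mulfV ?mul1r// expf_neq0// gt_eqF.
have yn : y ^+ n * expR (- y) <= n`!%:R.
  rewrite expRN ler_pdivrMr ?expR_gt0//.
  by apply: exprn_le_expR; rewrite mulr_ge0// ltW.
have dn : 0 <= (d / 2) ^- n * 2 * L.
  by rewrite !mulr_ge0 ?invr_ge0 ?exprn_ge0// ltW.
by have := ler_wpM2r dn yn; rewrite /c; congr (_ <= _); ring.
Qed.

Lemma integrable_poly_laplace (q : {poly R}) d : 0 < d ->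
  mu.-integrable setT (fun z => (q.[z] * laplace_pdf d z)%:E).
Proof.
move=> d0.
under [X in _.-integrable _ X]eq_fun do
  rewrite horner_coef mulr_suml -sumEFin.
apply: integrable_sum => //= i _.
under [X in _.-integrable _ X]eq_fun do rewrite -mulrA EFinM.
by apply: integrableZl => //; exact: integrable_exprn_laplace.
Qed.

End laplace.

(** * The difference of two lottery densities smoothed by Laplace noise *)

Section laplace_gap.
Context {R : realType}.
Local Notation mu := (@lebesgue_measure R).
Local Open Scope classical_set_scope.

(** For [s <= t], factor out [expR (- s) <= 1]; what remains is [1 - expR (- (t - s)) <= t - s]. *)
Lemma ler_expRN_dist (s t : R) : 0 <= s -> 0 <= t ->
  `|expR (- s) - expR (- t)| <= `|s - t|.
Proof.
wlog st : s t / s <= t => [hw|] s0 t0.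
  by have [st|/ltW ts] := leP s t; last rewrite distrC (distrC s); exact: hw.
rewrite distrC (ler0_norm (x := s - t)) ?subr_le0// opprB.
rewrite ler0_norm ?subr_le0 ?ler_expR ?lerN2// opprB.
rewrite (_ : - t = - s + - (t - s)) ?expRD; last by ring.
rewrite -{1}[expR (- s)]mulr1 -mulrBr.
have e1 : expR (- s) <= 1 by rewrite expR_le1 oppr_le0.
have e2 := expR_ge1Dx (- (t - s)).
have e3 : expR (- (t - s)) <= 1 by rewrite expR_le1 oppr_le0 subr_ge0.
apply: (@le_trans _ _ (1 * (1 - expR (- (t - s))))); last by lra.
by rewrite ler_wpM2r// subr_ge0.
Qed.

(** The tangent bound [1 + x <= expR x] costs no error in [x]; for [y], the same bound at [- y]
    gives [expR y <= (1 - y)^-1], which is at most [1 + y + 2 * y ^+ 2] for small [y]. *)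
Lemma expRB_ge (x y : R) : `|y| <= 2^-1 ->
  x - y - 2 * y ^+ 2 <= expR x - expR y.
Proof.
move=> y2; have ex := expR_ge1Dx x; have eNy := expR_ge1Dx (- y).
suff ey : expR y <= 1 + y + 2 * y ^+ 2 by lra.
have {y2} /andP[y1 y2] : - 2^-1 <= y <= 2^-1 by rewrite -ler_norml.
have y0 : 0 < 1 - y by lra.
rewrite -[y in expR y]opprK expRN.
apply: (@le_trans _ _ (1 - y)^-1); first by rewrite lef_pV2 ?posrE ?expR_gt0.
rewrite -[(1 - y)^-1]mul1r ler_pdivrMr//.
(* This is the expansion of [(1 + y + 2 * y ^+ 2) * (1 - y) - 1]. *)
have : 0 <= y ^+ 2 * (1 - 2 * y) by rewrite mulr_ge0 ?sqr_ge0//; lra.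
by nra.
Qed.

Variable I : finType.
Implicit Types (q a b : I -> R).

(** The [phi] of the overview: if [A] takes the value [a k] with weight [q k], then [A - Z] has
    density [\sum_k q k * laplace_pdf d (a k - w)] at [w], and likewise for [B]. *)
Definition laplace_gap q a b (d w : R) : R :=
  \sum_k q k * (laplace_pdf d (a k - w) - laplace_pdf d (b k - w)).

(** This symmetry reduces the negative half-line to the positive one: negating and exchanging the
    lotteries preserves the order of their means. *)
Lemma laplace_gapN q a b d w :
  laplace_gap q (fun k => - b k) (fun k => - a k) d (- w) =
  - laplace_gap q a b d w.
Proof.
rewrite /laplace_gap -sumrN; apply: eq_bigr => k _.
have pdfE c : laplace_pdf d (- c - - w) = laplace_pdf d (c - w).
  by rewrite -opprD laplace_pdfN.
by rewrite !pdfE -[RHS]mulrN opprB.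
Qed.

(** One factor [d] comes from the height of the density, the other from the Lipschitz constant of
    its exponent, so the bound is of order [d ^+ 2] uniformly in [w]. *)
Lemma normr_laplace_gap_le q a b M d w : 0 <= d -> (forall k, 0 <= q k) ->
  (forall k, `|a k| <= M) -> (forall k, `|b k| <= M) ->
  `|laplace_gap q a b d w| <= d / 2 * (d * (2 * M)) * \sum_k q k.
Proof.
move=> d0 q0 aM bM; rewrite mulr_sumr (le_trans (ler_norm_sum _ _ _))//.
apply: ler_sum => k _.
rewrite normrM (ger0_norm (q0 k)) mulrC ler_wpM2r//.
rewrite /laplace_pdf -mulrBr normrM (ger0_norm (x := d / 2)) ?divr_ge0//.
rewrite ler_wpM2l ?divr_ge0//.
apply: le_trans (ler_expRN_dist _ _) _; rewrite ?mulr_ge0//.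
rewrite -mulrBr normrM (ger0_norm d0) ler_wpM2l//.
apply: le_trans (ler_dist_dist _ _) _.
rewrite (_ : a k - w - (b k - w) = a k - b k); last by ring.
by rewrite (le_trans (ler_normB _ _))// mulrDl mul1r lerD.
Qed.

(** Beyond [M] the distance [|c - w|] is [w - c] for every value [c] of the lotteries, so
    [expR (- (d * w))] factors out and [expRB_ge] at [d * a k] and [d * b k] leaves the difference
    of the means at first order. *)
Lemma laplace_gap_ge q a b M d w : 0 <= d -> (forall k, 0 <= q k) ->
  (forall k, `|a k| <= M) -> (forall k, `|b k| <= M) ->
  d * M <= 2^-1 -> M <= w ->
  d / 2 * expR (- (d * w)) *
    (d * (\sum_k q k * a k - \sum_k q k * b k) -
      2 * (d * M) ^+ 2 * \sum_k q k) <= laplace_gap q a b d w.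
Proof.
move=> d0 q0 aM bM dM Mw.
rewrite -sumrB !mulr_sumr -sumrB mulr_sumr; apply: ler_sum => k _.
have pdfE c : `|c| <= M ->
    laplace_pdf d (c - w) = d / 2 * expR (- (d * w)) * expR (d * c).
  move=> cM; rewrite /laplace_pdf -[RHS]mulrA -expRD ler0_norm; last first.
    by rewrite subr_le0 (le_trans (ler_norm _))// (le_trans cM).
  by congr (_ * expR _); ring.
rewrite !pdfE// -[X in _ <= q k * X]mulrBr [leRHS]mulrCA.
rewrite ler_wpM2l ?mulr_ge0 ?expR_ge0//.
rewrite [leLHS](_ : _ = q k * (d * a k - d * b k - 2 * (d * M) ^+ 2));
  last by ring.
rewrite ler_wpM2l//.
have bdM : `|d * b k| <= d * M by rewrite normrM ger0_norm// ler_wpM2l.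
apply: le_trans (expRB_ge _ (le_trans bdM dM)).
rewrite lerD2l lerN2 ler_wpM2l//.
by rewrite -[leLHS]real_normK ?num_real// lerXn2r// nnegrE// (le_trans _ bdM).
Qed.

(* For a nondecreasing [u] with [u 0 = 0], the positive mass that the gap
   carries on [(M, M + T]] is weighted at least as much as the mass of unknown
   sign that it carries on [(0, M]]. *)
Lemma laplace_gap_half q a b : (forall k, 0 <= q k) ->
  \sum_k q k * b k < \sum_k q k * a k ->
  \forall d \near 0^'+, forall u : R -> R, {homo u : x y / x <= y} -> u 0 = 0 ->
  exists h : R -> R, [/\ mu.-integrable setT (EFin \o h),
    0 <= \int[mu]_w h w, forall w, w <= 0 -> h w = 0 &
    forall w, 0 < w -> h w <= u w * laplace_gap q a b d w].
Proof.
move=> q0 ab; pose M := 1 + \sum_k (`|a k| + `|b k|).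
(* Only half of the difference of the means is kept; the other half absorbs the quadratic error of
   [laplace_gap_ge]. *)
pose eta := (\sum_k q k * a k - \sum_k q k * b k) / 2.
(* [T] is the length of tail that compensates []0, M]]: it makes [eta * T] exceed
   [4 * M ^+ 2 * Q]. *)
pose Q := \sum_k q k; pose T := 1 + 4 * M ^+ 2 * Q / eta.
have eta0 : 0 < eta by rewrite divr_gt0// subr_gt0.
have Q0 : 0 <= Q by apply: sumr_ge0.
have S0 : 0 <= \sum_k (`|a k| + `|b k|).
  by apply: sumr_ge0 => k _; exact: addr_ge0.
have M0 : 0 < M by rewrite ltr_pwDl.
have T0 : 0 < T.
  rewrite ltr_pwDl// divr_ge0 ?(ltW eta0)// mulr_ge0// mulr_ge0//.
  by rewrite exprn_ge0// ltW.
have abM k : `|a k| + `|b k| <= M.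
  rewrite /M (bigD1 k)//= addrCA lerDl addr_ge0//.
  by apply: sumr_ge0 => j _; exact: addr_ge0.
have aM k : `|a k| <= M by apply: le_trans (abM k); rewrite lerDl.
have bM k : `|b k| <= M by apply: le_trans (abM k); rewrite lerDr.
have MT0 : 0 < M + T by rewrite addr_gt0.
have MQ0 : 0 < 1 + 2 * M ^+ 2 * Q.
  by rewrite ltr_pwDl// mulr_ge0// mulr_ge0// exprn_ge0// ltW.
near=> d.
have d0 : 0 < d by near: d; exact: nbhs_right_gt.
(* This keeps [d * w <= 2^-1], hence [expR (- (d * w)) >= 2^-1], for [w] up to [M + T]. *)
have dMT : d * (M + T) <= 2^-1.
  by rewrite -ler_pdivlMr//; near: d; apply: nbhs_right_le; rewrite divr_gt0.
(* This makes the quadratic error [2 * (d * M) ^+ 2 * Q] at most [d * eta]. *)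
have dMQ : d * (1 + 2 * M ^+ 2 * Q) <= eta.
  by rewrite -ler_pdivlMr//; near: d; apply: nbhs_right_le; rewrite divr_gt0.
have dM : d * M <= 2^-1.
  by apply: le_trans dMT; rewrite ler_wpM2l// ?lerDl ltW.
(* [kappa] bounds the gap from below on []M, M + T]], its last factor 1/2 standing for the
   exponential; [K] bounds its absolute value everywhere. *)
pose kappa := d / 2 * (d * eta / 2).
pose K := d / 2 * (d * (2 * M)) * Q.
have K0 : 0 <= K by rewrite !mulr_ge0// ltW.
have gapK w : `|laplace_gap q a b d w| <= K.
  by rewrite normr_laplace_gap_le// ltW.
have gap_tail w : M <= w -> d / 2 * expR (- (d * w)) * (d * eta) <=
    laplace_gap q a b d w.
  move=> Mw; apply: le_trans (laplace_gap_ge (ltW d0) q0 aM bM dM Mw).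
  rewrite ler_wpM2l ?mulr_ge0 ?expR_ge0 ?invr_ge0 ?(ltW d0)//.
  rewrite (_ : \sum_k _ - _ = 2 * eta); last by rewrite /eta; field.
  rewrite -/Q exprMn expr2 -!mulrA.
  have := ler_wpM2l (ltW d0) dMQ; have := sqr_ge0 d. lra.
move=> u u_homo u0; have uM0 : 0 <= u M by rewrite -u0 u_homo// ltW.
(* By monotonicity [u <= u M] where the gap may be as low as [- K], and [u >= u M] where it is at
   least [kappa], so replacing [u] by the constant [u M] only lowers the product. *)
pose h w := u M * (kappa * \1_`]M, M + T] w - K * \1_`]0, M] w).
have iI (s t : R) : mu.-integrable setT (EFin \o \1_`]s, t]).
  exact: integrable_indic_itv.
have iT : mu.-integrable setT (fun w => (kappa * \1_`]M, M + T] w)%:E).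
  under [X in _.-integrable _ X]eq_fun do rewrite EFinM.
  by apply: integrableZl => //; exact: integrable_indic_itv.
have iM : mu.-integrable setT (fun w => (K * \1_`]0, M] w)%:E).
  under [X in _.-integrable _ X]eq_fun do rewrite EFinM.
  by apply: integrableZl => //; exact: integrable_indic_itv.
have iTM : mu.-integrable setT
    (fun w => (kappa * \1_`]M, M + T] w - K * \1_`]0, M] w)%:E).
  under [X in _.-integrable _ X]eq_fun do rewrite EFinB.
  exact: integrableB.
exists h; split.
- rewrite /h /comp; under [X in _.-integrable _ X]eq_fun do rewrite EFinM.
  exact: integrableZl.
- rewrite /h RintegralZl// mulr_ge0// RintegralB// !RintegralZl//.
  rewrite /Rintegral !integral_indic//= !setIT !lebesgue_measure_itv/= !lte_fin.
  rewrite M0 ltrDl T0 /= oppr0 addr0 addrAC subrr add0r.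
  (* The integral of [h] is [u M * (kappa * T - K * M)], and this identity turns the second factor
     into [d ^+ 2 * eta / 4]. *)
  have : eta * T = eta + 4 * M ^+ 2 * Q.
    by rewrite /T mulrDr mulr1 mulrC divfK// gt_eqF.
  have := sqr_ge0 d; rewrite /kappa /K.
  nra.
- move=> w w0; rewrite /h !indicE !memNset ?mulr0 ?subr0 ?mulr0//=;
    rewrite in_itv/=; apply/negP; rewrite negb_and -leNgt.
  + by rewrite w0.
  + by rewrite (le_trans w0)// ltW.
- move=> w w0; rewrite /h.
  have [wM|Mw] := leP w M.
    rewrite !indicE memNset/=; last by rewrite in_itv/= ltNge wM.
    rewrite mem_set/= ?in_itv/= ?w0// mulr0 mulr1 sub0r.
    have uw0 : 0 <= u w by rewrite -u0 u_homo// ltW.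
    apply: (@le_trans _ _ (u w * - K)).
      by rewrite !mulrN lerN2 ler_wpM2r// u_homo.
    by rewrite ler_wpM2l//; have := gapK w; rewrite ler_norml => /andP[].
  rewrite [X in _ - _ * X]indicE memNset/=; last first.
    by rewrite in_itv/= leNgt Mw andbF.
  rewrite mulr0 subr0.
  have gw0 : 0 <= laplace_gap q a b d w.
    apply: le_trans (gap_tail _ (ltW Mw)).
    rewrite mulr_ge0 ?(mulr_ge0 (ltW d0) (ltW eta0))//.
    by rewrite mulr_ge0 ?expR_ge0// divr_ge0// ltW.
  apply: (@le_trans _ _ (u M * laplace_gap q a b d w)); last first.
    by rewrite ler_wpM2r// u_homo// ltW.
  rewrite ler_wpM2l// indicE.
  have [/[!inE]/=|_] := boolP (w \in _); last by rewrite mulr0.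
  rewrite in_itv/= => /andP[_ wMT]; rewrite mulr1.
  apply: le_trans (gap_tail _ (ltW Mw)).
  rewrite /kappa -[leRHS]mulrA ler_wpM2l ?divr_ge0 ?(ltW d0)//.
  rewrite [leLHS]mulrC ler_wpM2r ?(mulr_ge0 (ltW d0) (ltW eta0))//.
  have := expR_ge1Dx (- (d * w)).
  have : d * w <= d * (M + T) by rewrite ler_wpM2l// ltW.
  lra.
Unshelve. all: by end_near. Qed.

End laplace_gap.

(** * First order dominance for utilities vanishing at 0 *)

Section normalized_dominance.
Context {R : realType}.
Local Notation mu := (@lebesgue_measure R).
Local Open Scope classical_set_scope.

Lemma Rintegral_sum d (T : measurableType d) (nu : {measure set T -> \bar R})
    (I : finType) (f : I -> T -> R) :
  (forall k, nu.-integrable setT (EFin \o f k)) ->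
  \int[nu]_x (\sum_k f k x) = \sum_k \int[nu]_x f k x.
Proof.
move=> fi; rewrite /Rintegral.
under eq_integral do rewrite -sumEFin.
rewrite integral_sum// sum_fine// => k _.
exact: (integrable_fin_num measurableT (fi k)).
Qed.

(** [laplace_gap_half] gives a minorant [h1] on the positive half-line and, for the lotteries [- b],
    [- a] and the utility [- u (- w)], a minorant [h2] for the reflected negative one. Then
    [h1 w + h2 (- w)] lies below [u] times the gap everywhere and has nonnegative integral. *)
Lemma laplace_dominance_at0 (I : finType) (q a b : I -> R) :
  (forall k, 0 <= q k) -> \sum_k q k * b k < \sum_k q k * a k ->
  \forall d \near 0^'+, forall u : R -> R, {homo u : y z / y <= z} -> u 0 = 0 ->
  (forall s, mu.-integrable setT (fun w => (u w * laplace_pdf d (s - w))%:E)) ->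
  \sum_k q k * (\int[mu]_w (u w * laplace_pdf d (b k - w))) <=
  \sum_k q k * (\int[mu]_w (u w * laplace_pdf d (a k - w))).
Proof.
move=> q0 ab.
have ba : \sum_k q k * - a k < \sum_k q k * - b k.
  have sumN c : \sum_k q k * - c k = - \sum_k q k * c k.
    by rewrite -sumrN; apply: eq_bigr => k _; rewrite mulrN.
  by rewrite !sumN ltrN2.
have H1 := laplace_gap_half q0 ab; have H2 := laplace_gap_half q0 ba.
apply: filterS2 H1 H2 => d H1 H2 u u_homo u0 iu.
have [h1 [ih1 h1_ge0 h1_0 h1_le]] := H1 u u_homo u0.
have [|| h2 [ih2 h2_ge0 h2_0 h2_le]] := H2 (fun w => - u (- w)).
- by move=> x y xy; rewrite lerN2 u_homo// lerN2.
- by rewrite oppr0 u0 oppr0.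
have ih2N : mu.-integrable setT (EFin \o (fun w => h2 (0 - w))).
  exact: (integrable_subl 0 ih2).
have ih : mu.-integrable setT (EFin \o (fun w => h1 w + h2 (0 - w))).
  rewrite /comp; under [X in _.-integrable _ X]eq_fun do rewrite EFinD.
  exact: integrableD.
have iqu c k : mu.-integrable setT
    (EFin \o (fun w => q k * (u w * laplace_pdf d (c k - w)))).
  rewrite /comp; under [X in _.-integrable _ X]eq_fun do rewrite EFinM.
  exact: integrableZl.
have iqB k : mu.-integrable setT (EFin \o (fun w =>
    q k * (u w * laplace_pdf d (a k - w)) -
    q k * (u w * laplace_pdf d (b k - w)))).
  rewrite /comp; under [X in _.-integrable _ X]eq_fun do rewrite EFinB.
  by apply: integrableB; [|exact: iqu|exact: iqu].
rewrite -subr_ge0 -sumrB.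
have -> : \sum_k (q k * (\int[mu]_w (u w * laplace_pdf d (a k - w))) -
      q k * (\int[mu]_w (u w * laplace_pdf d (b k - w)))) =
    \int[mu]_w (\sum_k (q k * (u w * laplace_pdf d (a k - w)) -
      q k * (u w * laplace_pdf d (b k - w)))).
  rewrite Rintegral_sum//; apply: eq_bigr => k _.
  rewrite RintegralB; [|by []|exact: iqu|exact: iqu].
  by rewrite !RintegralZl//; exact: iu.
apply: (@le_trans _ _ (\int[mu]_w (h1 w + h2 (0 - w)))).
  rewrite RintegralD// addr_ge0//.
  by rewrite /Rintegral (integral_subl 0 ih2).
apply: le_Rintegral => //.
  rewrite /comp; under [X in _.-integrable _ X]eq_fun do rewrite -sumEFin.
  by apply: integrable_sum => // k _; exact: iqB.
move=> w _; rewrite [leRHS](_ : _ = u w * laplace_gap q a b d w); last first.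
  by rewrite /laplace_gap mulr_sumr; apply: eq_bigr => k _; ring.
rewrite sub0r; have [w0|w0] := leP w 0.
  rewrite h1_0// add0r; move: w0; rewrite le_eqVlt => /predU1P[->|w0].
    by rewrite oppr0 h2_0// u0 mul0r.
  have := h2_le (- w); rewrite oppr_gt0 => /(_ w0).
  by rewrite laplace_gapN opprK mulrNN.
by rewrite h2_0 ?addr0 ?h1_le// oppr_le0 ltW.
Qed.

End normalized_dominance.

(** * Expected utility under Laplace noise *)

Section laplace_noise.
Context {R : realType}.
Local Notation mu := (@lebesgue_measure R).
Local Open Scope classical_set_scope.

(* [measurableTypeR R] carries the display of [lebesgue_measure], which is not
   convertible to the canonical display of [R]. *)
Definition is_laplace (d : R) (P : probability (measurableTypeR R) R) : Prop :=
  forall A, measurable A -> P A = (\int[mu]_(z in A) (laplace_pdf d z)%:E)%E.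

Lemma exists_laplace d : 0 < d -> exists P, is_laplace d P.
Proof.
move=> d0; have pdf_ge0 z := laplace_pdf_ge0 z (ltW d0).
exact: (@probability_of_density _ _ _ (@lebesgue_measure R) _ pdf_ge0
  (measurable_laplace_pdf d) (integral_laplace_pdf d0)).
Qed.

Lemma poly_bounded_subl (u : R -> R) s : poly_bounded u ->
  poly_bounded (fun z => u (s - z)).
Proof.
by case=> r ur; exists (r \Po (s%:P - 'X)) => z; rewrite horner_comp !hornerE.
Qed.

Lemma poly_bounded_horner (r : {poly R}) : poly_bounded (fun z => r.[z]).
Proof.
(* [1 + y ^+ 2] dominates [|y|] and stays polynomial. *)
by exists (1 + r ^+ 2) => z; rewrite !hornerE; case: (ger0P r.[z]) => _; nra.
Qed.

Lemma measurable_horner (r : {poly R}) :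
  measurable_fun setT (fun z : R => r.[z]).
Proof. by apply: continuous_measurable_fun; exact: continuous_horner. Qed.

Lemma integrable_mul_laplace d (h : R -> R) : 0 < d ->
  measurable_fun setT h -> poly_bounded h ->
  mu.-integrable setT (fun z => (h z * laplace_pdf d z)%:E).
Proof.
move=> d0 mh [r hr].
apply: le_integrable (integrable_poly_laplace r d0) => //.
  apply/measurable_EFinP; apply: measurable_funM => //.
  exact: measurable_laplace_pdf.
move=> z _; rewrite !abse_EFin lee_fin !normrM ler_wpM2r//.
by rewrite (le_trans (hr z))// ler_norm.
Qed.

Section fixed_rate.
Variables (d : R) (P : probability (measurableTypeR R) R).
Hypotheses (d0 : 0 < d) (P_laplace : is_laplace d P).

Lemma integral_laplace (h : R -> R) :
  measurable_fun setT h -> poly_bounded h ->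
  P.-integrable setT (EFin \o h) /\
  \int[P]_z h z = \int[mu]_z (h z * laplace_pdf d z).
Proof.
move=> mh bh; have pdf_ge0 z := laplace_pdf_ge0 z (ltW d0).
have [ih Eh] := @integral_density _ _ _ (@lebesgue_measure R) _ pdf_ge0
  (measurable_laplace_pdf d) P P_laplace h mh (integrable_mul_laplace d0 mh bh).
by split => //; rewrite /Rintegral Eh.
Qed.

(** The density is even, so the reflection [z |-> - z] shows that the mean equals its own
    opposite. *)
Lemma Rintegral_laplace_id : \int[P]_z z = 0.
Proof.
have mid : measurable_fun setT (@idfun R) by exact: measurable_id.
have bid : poly_bounded (@idfun R).
  rewrite (_ : idfun = (fun z : R => 'X.[z])); last first.
    by apply/funext => z; rewrite hornerX.
  exact: poly_bounded_horner.
have [_ ->] := integral_laplace mid bid.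
have iz := integrable_mul_laplace d0 mid bid.
set c := LHS; suff : c = - c by lra.
rewrite {1}/c /Rintegral -(integral_subl 0 iz) /c -[RHS]mulN1r -RintegralZl//.
congr fine; apply: eq_integral => z _.
by rewrite sub0r laplace_pdfN mulNr mulN1r.
Qed.

(** The substitution [w = s - z] moves the shift from the utility to the density, so that different
    lotteries are compared by integrating one fixed [u] against different densities. *)
Lemma Rintegral_laplace_subl (u : R -> R) s :
  measurable_fun setT u -> poly_bounded u ->
  mu.-integrable setT (fun w => (u w * laplace_pdf d (s - w))%:E) /\
  \int[P]_z u (s - z) = \int[mu]_w (u w * laplace_pdf d (s - w)).
Proof.
move=> mu_ bu.
have mus : measurable_fun setT (fun z : R => u (s - z)).
  by apply: measurableT_comp => //; exact: measurable_funB.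
have bus := poly_bounded_subl s bu.
have [_ ->] := integral_laplace mus bus.
have := integrable_subl s (integrable_mul_laplace d0 mus bus).
under [X in _.-integrable _ X]eq_fun do rewrite subKr.
move=> iu; split => //.
rewrite /Rintegral -(integral_subl s iu); congr fine.
by apply: eq_integral => z _; rewrite subKr.
Qed.

End fixed_rate.

(** Since [P] has mass one, passing from [u] to [u - u 0] shifts both sides by the same
    [(\sum_k q k) * u 0], which reduces to the normalized case. *)
Lemma laplace_dominance (I : finType) (q a b : I -> R) :
  (forall k, 0 <= q k) -> \sum_k q k * b k < \sum_k q k * a k ->
  \forall d \near 0^'+, forall P, is_laplace d P ->
  forall u : R -> R, {homo u : y z / y <= z} -> poly_bounded u ->
  \sum_k q k * (\int[P]_z u (b k - z)) <= \sum_k q k * (\int[P]_z u (a k - z)).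
Proof.
move=> q0 ab; have := laplace_dominance_at0 q0 ab.
have : \forall d \near 0^'+, 0 < d :> R by exact: nbhs_right_gt.
apply: filterS2 => d d0 dom P P_laplace u u_homo bu.
have mu_ : measurable_fun setT u by exact: nondecreasing_measurable.
pose u1 w := u w - u 0.
have mu1 : measurable_fun setT u1 by exact: measurable_funB.
have bu1 : poly_bounded u1.
  case: bu => r ur; exists (r + `|u 0|%:P) => z.
  by rewrite !hornerE (le_trans (ler_normB _ _))// lerD2r.
have Eu s : \int[P]_z u (s - z) = \int[P]_z u1 (s - z) + u 0.
  have mu1s : measurable_fun setT (fun z : R => u1 (s - z)).
    by apply: measurableT_comp => //; exact: measurable_funB.
  have [iu _] := integral_laplace d0 P_laplace mu1s (poly_bounded_subl s bu1).
  under eq_Rintegral do rewrite -[u _](subrK (u 0)).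
  rewrite RintegralD//=; last exact: finite_measure_integrable_cst.
  by rewrite Rintegral_cst//= probability_setT mulr1.
under eq_bigr do
  rewrite Eu mulrDr (Rintegral_laplace_subl d0 P_laplace _ mu1 bu1).2.
under [leRHS]eq_bigr do
  rewrite Eu mulrDr (Rintegral_laplace_subl d0 P_laplace _ mu1 bu1).2.
rewrite !big_split/= lerD2r; apply: dom.
- by move=> y z yz; rewrite lerD2r u_homo.
- by rewrite /u1 subrr.
- by move=> s; exact: (Rintegral_laplace_subl d0 P_laplace s mu1 bu1).1.
Qed.

End laplace_noise.

(** * Transfers shifted by one common noise *)

Section common_noise.
Context (R : realType) (n : nat) (P : probability (measurableTypeR R) R).
Variable m : 'I_n -> R.

Let shift (z : measurableTypeR R) : n.-tuple R := [tuple m i + z | i < n].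

Let measurable_shift : measurable_fun setT shift.
Proof.
apply/measurable_fun_tnthP => i.
rewrite (_ : _ \o _ = (fun z : R => m i + z)); last first.
  by apply/funext => z; rewrite /shift /= tnth_mktuple.
exact: measurable_funD.
Qed.

HB.instance Definition _ := isMeasurableFun.Build _ _ _ _ _ measurable_shift.

(** Each agent's utility involves her own transfer only, so the marginals are all that matters and
    one scalar noise can serve all coordinates. A general [h] covers moments, utilities and means at
    once. *)
Lemma exists_common_noise : exists tau : transfer_law R n,
  forall (i : 'I_n) (h : R -> R), measurable_fun setT h ->
  P.-integrable setT (fun z => (h (m i + z))%:E) ->
  tau.-integrable setT (fun y => (h (transfer_of i y))%:E) /\
  (\int[tau]_y (h (transfer_of i y))%:E = \int[P]_z (h (m i + z))%:E)%E.
Proof.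
exists (distribution P shift) => i h mh ih.
have mhi : measurable_fun setT (fun y : n.-tuple R => (h (transfer_of i y))%:E).
  apply/measurable_EFinP; apply: measurableT_comp => //.
  exact: measurable_tnth.
have hE : (fun y : n.-tuple R => (h (transfer_of i y))%:E) \o shift =
    (fun z => (h (m i + z))%:E).
  by apply/funext => z; rewrite /= /transfer_of /shift tnth_mktuple.
split; last by rewrite integral_distribution// hE.
by apply: integrable_pushforward => //; rewrite hE.
Qed.

End common_noise.

(** * The noisy mechanism *)

Theorem proposition3 (R : realType) (n : nat) (Theta : 'I_n -> finType)
    (p : profile Theta -> R) (X : Type) (v : 'I_n -> X -> profile Theta -> R)
    (x : profile Theta -> X) (t : profile Theta -> transfer_law R n)
    (hp : is_pmf p) (ht : finite_moments t)
    (hBIC : strictly_BIC_quasilinear p v x t) :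
  exists tau : profile Theta -> transfer_law R n,
    [/\ finite_moments tau,
        ordinally_IC p v x tau &
        forall (th : profile Theta) (i : 'I_n),
          ('E_(tau th)[transfer_of i] = 'E_(t th)[transfer_of i])%E].
Proof.
pose m th i := fine ('E_(t th)[transfer_of i])%E.
have it th i : (t th).-integrable setT (EFin \o @transfer_of R n i).
  exact: (ht th i 1%N).
have Et th i : ('E_(t th)[transfer_of i] = (m th i)%:E)%E.
  by rewrite fineK// unlock; exact: (integrable_fin_num measurableT (it th i)).
have EtB th i (c : R) : ('E_(t th)[fun y => (c - transfer_of i y)%R] =
    (c - m th i)%:E)%E.
  rewrite unlock; under eq_integral do rewrite EFinB.
  rewrite (integralB measurableT _ (it th i)) /=; last first.
    exact: finite_measure_integrable_cst.
  rewrite integral_cst//= probability_setT mule1 EFinB -Et; congr (_ - _)%E.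
  by rewrite unlock.
(* The conditional law given type [a], extended by 0 to all profiles so that sums run over the whole
   index type, as the dominance lemma requires. *)
pose q i (a : Theta i) (th : profile Theta) :=
  if th i == a then p th / type_prob p a else 0.
(* The value net of the mean transfer after report [b]; [w i a a] and [w i a b] are the lotteries
   [A] and [B] of the overview. *)
pose w i (a b : Theta i) (th : profile Theta) :=
  v i (x (deviate th b)) th - m (deviate th b) i.
have q0 i (a : Theta i) th : 0 < type_prob p a -> 0 <= q i a th.
  by move=> a0; rewrite /q; case: ifP => // _; rewrite divr_ge0 ?hp.1// ltW.
have interimE s i ui (a b : Theta i) (e : profile Theta -> R) :
    (forall th, ('E_(s (deviate th b))[fun y =>
      ui (v i (x (deviate th b)) th - transfer_of i y)%R] = (e th)%:E)%E) ->
    interim_utility p v x s ui a b = (\sum_th q i a th * e th)%:E.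
  move=> sE; rewrite /interim_utility.
  under eq_bigr do rewrite sE -EFinM.
  rewrite sumEFin; congr EFin; rewrite big_mkcond; apply: eq_bigr => th _.
  by rewrite /q; case: ifP => // _; rewrite mul0r.
have strict i (a b : Theta i) : 0 < type_prob p a -> b != a ->
    \sum_th q i a th * w i a b th < \sum_th q i a th * w i a a th.
  move=> a0 ba.
  have tE c : interim_utility p v x t (fun z => z) a c =
      (\sum_th q i a th * w i a c th)%:E.
    by apply: interimE => th; rewrite EtB.
  have := hBIC.1 i a a0 b; rewrite !tE lee_fin le_eqVlt => /predU1P[E|//].
  (* A report that ties with the truth would itself be a maximizer, against uniqueness. *)
  case/eqP: ba; apply: (hBIC.2 i a a0) => c.
  by rewrite !tE E -!tE; exact: hBIC.1.
pose dominated d := forall i (a b : Theta i), 0 < type_prob p a -> b != a ->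
  forall P, is_laplace d P ->
  forall u : R -> R, {homo u : y z / y <= z} -> poly_bounded u ->
  \sum_th q i a th * (\int[P]_z u (w i a b th - z)) <=
  \sum_th q i a th * (\int[P]_z u (w i a a th - z)).
(* Agents, types and reports are finite in number, so the thresholds on [d] can be intersected. *)
have near_dom : \forall d \near ((0 : R)^'+)%classic, dominated d.
  apply: filter_forall => i; apply: filter_forall => a.
  apply: filter_forall => b.
  have [a0|a0] := ltP 0 (type_prob p a); last exact: nearW.
  have [->|ba] := eqVneq b a; first exact: nearW.
  have := laplace_dominance (fun th => q0 i a th a0) (strict i a b a0 ba).
  by apply: filterS => d H _ _.
have [d [d0 dom]] := filter_ex (filterI (nbhs_right_gt (0 : R)) near_dom).
have [P P_laplace] := exists_laplace d0.
have [tau tauE] := choice (fun th => exists_common_noise P (m th)).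
exists tau; split.
- move=> th i k.
  have mk : measurable_fun setT (fun y : R => y ^+ k).
    exact: exprn_measurable.
  apply: (tauE th i _ mk _).1.
  (* A moment of the shifted noise is the integral of a polynomial in [z]. *)
  have -> : (fun z : R => ((m th i + z) ^+ k)%:E) =
      EFin \o (fun z => (((m th i)%:P + 'X) ^+ k).[z]).
    by apply/funext => z /=; rewrite !hornerE.
  apply: (integral_laplace d0 P_laplace _ _).1; first exact: measurable_horner.
  exact: poly_bounded_horner.
- move=> u u_homo bu i a a0 b.
  have [->//|ba] := eqVneq b a.
  have tauu c : interim_utility p v x tau (u i) a c =
      (\sum_th q i a th * \int[P]_z u i (w i a c th - z))%:E.
    apply: interimE => th; rewrite unlock.
    have mu_ : measurable_fun setT (u i) by exact: nondecreasing_measurable.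
    pose s := v i (x (deviate th c)) th; pose h (y : R) := u i (s - y).
    have mh : measurable_fun setT h.
      by apply: measurableT_comp => //; exact: measurable_funB.
    have wE z : h (m (deviate th c) i + z) = u i (w i a c th - z).
      by rewrite /h opprD addrA.
    have muw : measurable_fun setT (fun z : R => u i (w i a c th - z)).
      by apply: measurableT_comp => //; exact: measurable_funB.
    have [iu _] :=
      integral_laplace d0 P_laplace muw (poly_bounded_subl _ (bu i)).
    rewrite (tauE (deviate th c) i h mh _).2; last first.
      by under [X in _.-integrable _ X]eq_fun do rewrite wE.
    under eq_integral do rewrite wE.
    by rewrite /Rintegral fineK//; exact: (integrable_fin_num measurableT iu).
  by rewrite !tauu lee_fin; apply: dom.
- move=> th i; rewrite Et unlock.
  have mid : measurable_fun setT (@idfun R) by exact: measurable_id.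
  have bX : poly_bounded (fun z : R => 'X.[z]) by exact: poly_bounded_horner.
  have [+ _] := integral_laplace d0 P_laplace (measurable_horner 'X) bX.
  rewrite (_ : EFin \o _ = EFin \o @idfun R); last first.
    by apply/funext => z; rewrite /= hornerX.
  move=> iid.
  have ic : P.-integrable setT (EFin \o cst (m th i)).
    exact: finite_measure_integrable_cst.
  have icz : P.-integrable setT (fun z : R => (m th i + z)%:E).
    under [X in _.-integrable _ X]eq_fun do rewrite EFinD.
    exact: integrableD.
  rewrite (tauE th i idfun mid icz).2.
  under eq_integral do rewrite EFinD.
  rewrite (integralD measurableT ic iid) /=.
  rewrite integral_cst//= probability_setT mule1.
  rewrite -[X in (_ + X)%E]fineK; last first.
    exact: (integrable_fin_num measurableT iid).
  by rewrite [fine _](Rintegral_laplace_id d0 P_laplace) adde0.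
Qed.
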